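(* Let $\mathcal{X}$ and $\mathcal{Y}$ be complex Banach spaces, let $A\in L(\mathcal{X})$ be of Kato type and let $B\in L(\mathcal{Y})$ admit a generalized Kato decomposition. If there exists some $C\in L(\mathcal{Y},\mathcal{X})$ such that $M_C=\begin{pmatrix} A & C\\ 0 & B\end{pmatrix}\in L(\mathcal{X}\oplus\mathcal{Y})$ is Drazin invertible, then the following hold: (i) $A$ is left Drazin invertible; (ii) $B$ is right Drazin invertible; (iii) there exists a constant $\delta>0$ such that $\beta(A-\lambda)=\alpha(B-\lambda)$ for every $\lambda\in\mathbb{C}$ with $0<|\lambda|<\delta$.
   Context: $L(\mathcal{X},\mathcal{Y})$ is the set of bounded linear operators from $\mathcal{X}$ to $\mathcal{Y}$, and $L(\mathcal{X})=L(\mathcal{X},\mathcal{X})$. $T-\lambda$ means $T-\lambda I$. The space $\mathcal{X}\oplus\mathcal{Y}$ of pairs carries the norm $\|(x,y)\|=(\|x\|^2+\|y\|^2)^{1/2}$, and $M_C(x,y)=(Ax+Cy,By)$. For $T\in L(\mathcal{X})$, $N(T)$ and $R(T)$ are the kernel and range, $\alpha(T)=\dim N(T)$, $\beta(T)=\operatorname{codim} R(T)$, with values in $\{0,1,2,\dots\}\cup\{\infty\}$. The ascent is $\operatorname{asc}(T)=\inf\{n\in\mathbb{N}_0: N(T^n)=N(T^{n+1})\}$ and the descent is $\operatorname{dsc}(T)=\inf\{n\in\mathbb{N}_0: R(T^n)=R(T^{n+1})\}$, with $\inf\emptyset=\infty$ and $\mathbb{N}_0=\{0,1,2,\dots\}$.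 $T\in L(\mathcal{X})$ is Drazin invertible if there exist $S\in L(\mathcal{X})$ and $k\in\mathbb{N}$ with $TS=ST$, $STS=S$, $T^kST=T^k$. $T$ is left Drazin invertible if $\operatorname{asc}(T)<\infty$ and $R(T^{\operatorname{asc}(T)+1})$ is closed. $T$ is right Drazin invertible if $\operatorname{dsc}(T)<\infty$ and $R(T^{\operatorname{dsc}(T)})$ is closed. $T$ is quasinilpotent if $T-\lambda$ is invertible for all complex $\lambda\neq0$, and nilpotent if $T^n=0$ for some $n\in\mathbb{N}$. $T$ is semi-regular if $R(T)$ is closed and $N(T)\subset R(T^m)$ for every $m\in\mathbb{N}$. $T$ admits a generalized Kato decomposition if there are closed $T$-invariant subspaces $M,N$ of $\mathcal{X}$ with $\mathcal{X}=M\oplus N$ such that $T|_M\in L(M)$ is semi-regular and $T|_N\in L(N)$ is quasinilpotent; $T$ is of Kato type if such a pair $M,N$ exists with $T|_M$ semi-regular and $T|_N$ nilpotent. *)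

(* Defs.v *)
From HB Require Import structures.
From mathcomp Require Import all_boot all_order all_algebra.
From mathcomp Require Import all_classical all_reals all_analysis.
From mathcomp Require Import complex.
From mathcomp Require Import ring.

Set Implicit Arguments.
Unset Strict Implicit.
Unset Printing Implicit Defensive.

Import Order.TTheory GRing.Theory Num.Theory.
Import numFieldNormedType.Exports.

Local Open Scope classical_set_scope.
Local Open Scope ring_scope.

Lemma sqrtC_minkowski (F : numClosedFieldType) (a b c d : F) :
    0 <= a -> 0 <= b -> 0 <= c -> 0 <= d ->
  sqrtC ((a + c) ^+ 2 + (b + d) ^+ 2)
    <= sqrtC (a ^+ 2 + b ^+ 2) + sqrtC (c ^+ 2 + d ^+ 2).
Proof.
move=> a0 b0 c0 d0.
set p := a ^+ 2 + b ^+ 2; set q := c ^+ 2 + d ^+ 2.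
have p0 : 0 <= p by rewrite addr_ge0 ?exprn_ge0.
have q0 : 0 <= q by rewrite addr_ge0 ?exprn_ge0.
have sp0 : 0 <= sqrtC p by rewrite sqrtC_ge0.
have sq0 : 0 <= sqrtC q by rewrite sqrtC_ge0.
have cs : a * c + b * d <= sqrtC p * sqrtC q.
  rewrite -ler_sqr ?nnegrE ?addr_ge0 ?mulr_ge0// exprMn !sqrtCK -subr_ge0.
  have -> : p * q - (a * c + b * d) ^+ 2 = (a * d - b * c) ^+ 2.
    by rewrite /p /q; ring.
  by rewrite real_exprn_even_ge0// rpredB ?ger0_real ?mulr_ge0.
rewrite -ler_sqr ?nnegrE ?addr_ge0 ?sqrtC_ge0 ?addr_ge0 ?exprn_ge0 ?addr_ge0//.
rewrite sqrtCK [leRHS]sqrrD !sqrtCK.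
have -> : (a + c) ^+ 2 + (b + d) ^+ 2 = p + (a * c + b * d) *+ 2 + q.
  by rewrite /p /q; ring.
by rewrite lerD2r lerD2l lerMn2r cs orbT.
Qed.

(* The direct sum of X and Y: the library equips X * Y with the max norm, so
   the Euclidean norm is put on an alias of this type. *)
Definition dsum (R : realType) (X Y : normedModType R[i]) : Type := (X * Y)%type.

Section DirectSum.
Variables (R : realType) (X Y : normedModType R[i]).

HB.instance Definition _ := GRing.Lmodule.copy (dsum X Y) (X * Y)%type.

Definition dsum_norm (z : dsum X Y) : R[i] :=
  sqrtC (`|z.1| ^+ 2 + `|z.2| ^+ 2).

Lemma dsum_normD (x y : dsum X Y) :
  dsum_norm (x + y) <= dsum_norm x + dsum_norm y.
Proof.
apply: le_trans (sqrtC_minkowski (normr_ge0 x.1) (normr_ge0 x.2)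
  (normr_ge0 y.1) (normr_ge0 y.2)).
rewrite ler_sqrtC ?nnegrE ?addr_ge0 ?exprn_ge0 ?addr_ge0//.
by apply: lerD; rewrite ler_sqr ?nnegrE ?addr_ge0// ler_normD.
Qed.

Lemma dsum_normZ (l : R[i]) (x : dsum X Y) :
  dsum_norm (l *: x) = `|l| * dsum_norm x.
Proof.
by rewrite /dsum_norm /= !normrZ !exprMn -mulrDr rootCMl ?exprn_ge0// sqrCK.
Qed.

Lemma dsum_norm_eq0 (x : dsum X Y) : dsum_norm x = 0 -> x = 0.
Proof.
case: x => x y /eqP; rewrite sqrtC_eq0 paddr_eq0 ?exprn_ge0//=.
by rewrite !expf_eq0/= !normr_eq0 => /andP[/eqP -> /eqP ->].
Qed.

HB.instance Definition _ := Lmodule_isNormed.Build R[i] (dsum X Y)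
  dsum_normD dsum_normZ dsum_norm_eq0.

End DirectSum.

(* The library has no normed-space structure on subspaces of normed spaces. *)
Definition subspace_type (R : realType) (X : normedModType R[i])
  (M : submodClosed X) : Type := {x : X | x \in M}.

Section SubspaceType.
Variables (R : realType) (X : normedModType R[i]) (M : submodClosed X).

HB.instance Definition _ := SubChoice.on (subspace_type M).
HB.instance Definition _ :=
  [SubChoice_isSubLmodule of subspace_type M by <:].

Definition sub_norm (x : subspace_type M) : R[i] := `|val x|.

Lemma sub_normD (x y : subspace_type M) :
  sub_norm (x + y) <= sub_norm x + sub_norm y.
Proof. by rewrite /sub_norm raddfD ler_normD. Qed.

Lemma sub_normZ (l : R[i]) (x : subspace_type M) :
  sub_norm (l *: x) = `|l| * sub_norm x.
Proof. by rewrite /sub_norm linearZ normrZ. Qed.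

Lemma sub_norm_eq0 (x : subspace_type M) : sub_norm x = 0 -> x = 0.
Proof. by move=> /normr0_eq0 x0; apply: val_inj; rewrite x0 raddf0. Qed.

HB.instance Definition _ := Lmodule_isNormed.Build R[i] (subspace_type M)
  sub_normD sub_normZ sub_norm_eq0.

End SubspaceType.

Section Operators.
Variable R : realType.
Implicit Types X Y : normedModType R[i].

Definition bounded_operator X Y (T : X -> Y) : Prop :=
  exists K : R[i], forall x, `|T x| <= K * `|x|.

Definition ker X Y (T : X -> Y) : set X := [set x | T x = 0].

Definition minus_scalar X (T : X -> X) (l : R[i]) : X -> X :=
  fun x => T x - l *: x.

Definition invertible X (T : X -> X) : Prop :=
  exists S : {linear X -> X},
    [/\ bounded_operator S, cancel T S & cancel S T].

(* The infimum in {0, 1, 2, ...} + {oo}; ereal_inf set0 = +oo. *)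
Definition nat_inf (P : set nat) : \bar R :=
  ereal_inf [set (n%:R : R)%:E | n in P].

(* The classes of v_0, ..., v_(n-1) form a basis of U / W (for W `<=` U). *)
Definition quotient_basis X (U W : set X) (n : nat) (v : 'I_n -> X) : Prop :=
  [/\ forall i, U (v i),
      forall a : 'I_n -> R[i], W (\sum_(i < n) a i *: v i) -> forall i, a i = 0
    & forall x, U x ->
        exists a : 'I_n -> R[i], W (x - \sum_(i < n) a i *: v i)].

(* dim (U / W), +oo when there is no finite basis. *)
Definition quotient_dim X (U W : set X) : \bar R :=
  nat_inf [set n | exists v : 'I_n -> X, quotient_basis U W v].

Definition alpha X (T : X -> X) : \bar R := quotient_dim (ker T) [set 0].

Definition beta X (T : X -> X) : \bar R := quotient_dim setT (range T).

Definition asc X (T : X -> X) : \bar R :=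
  nat_inf [set n | ker (iter n T) = ker (iter n.+1 T)].

Definition dsc X (T : X -> X) : \bar R :=
  nat_inf [set n | range (iter n T) = range (iter n.+1 T)].

Definition drazin_invertible X (T : X -> X) : Prop :=
  exists (S : {linear X -> X}) (k : nat),
    [/\ bounded_operator S, (0 < k)%N,
        T \o S =1 S \o T,
        S \o T \o S =1 S
      & iter k T \o S \o T =1 iter k T].

Definition left_drazin_invertible X (T : X -> X) : Prop :=
  exists2 p : nat, asc T = (p%:R : R)%:E & closed (range (iter p.+1 T)).

Definition right_drazin_invertible X (T : X -> X) : Prop :=
  exists2 q : nat, dsc T = (q%:R : R)%:E & closed (range (iter q T)).

Definition quasinilpotent X (T : X -> X) : Prop :=
  forall l : R[i], l != 0 -> invertible (minus_scalar T l).

Definition nilpotent_operator X (T : X -> X) : Prop :=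
  exists2 n : nat, (0 < n)%N & forall x, iter n T x = 0.

Definition semi_regular X (T : X -> X) : Prop :=
  closed (range T) /\
  forall m : nat, (0 < m)%N -> ker T `<=` range (iter m T).

Definition invariant X (T : X -> X) (M : submodClosed X) : Prop :=
  forall x, x \in M -> T x \in M.

Definition restrict X (T : X -> X) (M : submodClosed X)
    (TM : invariant T M) (x : subspace_type M) : subspace_type M :=
  exist _ (T (val x)) (TM (val x) (valP x)).

Definition direct_sum X (M N : submodClosed X) : Prop :=
  (forall x, exists u v, [/\ u \in M, v \in N & x = u + v]) /\
  (forall x, x \in M -> x \in N -> x = 0).

Definition kato_decomposition X (T : X -> X)
    (P : forall Z : normedModType R[i], (Z -> Z) -> Prop) : Prop :=
  exists (M N : submodClosed X) (TM : invariant T M) (TN : invariant T N),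
    [/\ closed [set` M], closed [set` N], direct_sum M N,
        semi_regular (restrict TM) & P _ (restrict TN)].

Definition generalized_kato X (T : X -> X) : Prop :=
  kato_decomposition T quasinilpotent.

Definition kato_type X (T : X -> X) : Prop :=
  kato_decomposition T nilpotent_operator.

Definition upper_triangular X Y (A : X -> X) (B : Y -> Y) (C : Y -> X)
  (z : dsum X Y) : dsum X Y := (A z.1 + C z.2, B z.2).

End Operators.

(* Main.v *)
Require Import Defs.
From HB Require Import structures.
From mathcomp Require Import all_boot all_order all_algebra.
From mathcomp Require Import all_classical all_reals all_analysis.
From mathcomp Require Import complex.
From mathcomp Require Import ring lra.
Import Order.TTheory GRing.Theory Num.Theory.
Import numFieldNormedType.Exports.
Local Open Scope classical_set_scope.
Local Open Scope ring_scope.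
Local Open Scope complex_scope.

Set Implicit Arguments.
Unset Strict Implicit.
Unset Printing Implicit Defensive.

(** Write [T] for the upper triangular operator and [S] for its Drazin inverse,
so that [T^k = S T^(k+1) = T^(k+1) S].

Index. For small [l != 0] the operator [T - l] is bijective: on the range of
the projection [T S] a solution is obtained from the Neumann series of
[1 - l S], and on its kernel [T] is nilpotent ([drazin_punctured]).  The map
induced by [C] from [ker (B - l)] to [X / range (A - l)] is then an
isomorphism, which gives the equality of [beta] and [alpha]
([upper_triangular_index]).

Left Drazin invertibility of [A]. As [A] is the restriction of [T] to [X],
[A^(k+1) x = 0] implies [A^k x = 0], so [A] has finite ascent [p].  On the
semi-regular summand of a Kato decomposition, finite ascent forces [A] to be
injective, hence bounded below by the open mapping theorem ([open_mapping]);
the powers of [A] then map this summand onto closed subspaces.  On the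
nilpotent summand [A^p = 0], so that [range (A^(p+1))] is the image of the
semi-regular summand alone ([kato_left_drazin]).

Right Drazin invertibility of [B]. Let [W] be the lower right corner of [S];
then [B^k = B^(k+1) W], so [B] has finite descent.  Let [Y = M + N] be a
generalized Kato decomposition of [B].  Finite descent forces [B] to be onto on
the semi-regular summand [M].  On the quasinilpotent summand [N] the kernels
of the powers are stable from [k] on: if [x] is in [N] and [B^(k+1) x = 0], the
vector [v = (1 - l W)^-1 x] satisfies [(B - l) B^k v = B^(k+1) x = 0], so
[B^k v] has no component in [N]; letting [l] tend to [0], [B^k x] is in the
closed subspace [M], hence is [0] ([gkd_ker_stable]).  Consequently the bounded
operator [E = 1 - B^k W^k], whose values lie in [ker (B^k)], maps [range (B^k)]
into [M].  It maps the closure of [range (B^k)] into [M] as well, and [M] is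
included in [range (B^k)]; the identity [y = E y + B^k W^k y] shows that this
range is closed ([gkd_right_drazin]).  The argument does not need the fact that
a quasinilpotent operator with finite descent is nilpotent. *)

(** * Real-valued norms and geometric convergence *)

(** The norm of a complex normed space takes its values in [R[i]]; [rnorm] is
the same norm with values in [R]. *)
Definition rnorm (R : realType) (V : normedZmodType R[i]) (x : V) : R :=
  complex.Re `|x|.

Section RealNorm.
Variable R : realType.
Implicit Types V : normedModType R[i].

Lemma rnormE (V : normedZmodType R[i]) (x : V) : `|x| = (rnorm x)%:C.
Proof.
have := normr_ge0 x; rewrite lecE/= => /andP[/eqP im0 _].
by rewrite /rnorm; case: `|x| im0 => a b /= ->.
Qed.

Lemma rnorm_ge0 (V : normedZmodType R[i]) (x : V) : 0 <= rnorm x.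
Proof. by rewrite -ler0c -rnormE. Qed.

Lemma rnormD (V : normedZmodType R[i]) (x y : V) :
  rnorm (x + y) <= rnorm x + rnorm y.
Proof. by rewrite -lecR rmorphD/= -!rnormE ler_normD. Qed.

Lemma rnormN (V : normedZmodType R[i]) (x : V) : rnorm (- x) = rnorm x.
Proof. by rewrite /rnorm normrN. Qed.

Lemma rnorm0 (V : normedZmodType R[i]) : rnorm (0 : V) = 0.
Proof. by rewrite /rnorm normr0. Qed.

Lemma rnorm_eq0 (V : normedZmodType R[i]) (x : V) : rnorm x = 0 -> x = 0.
Proof. by move=> x0; apply: normr0_eq0; rewrite rnormE x0. Qed.

Lemma rnormB (V : normedZmodType R[i]) (x y : V) :
  rnorm (x - y) <= rnorm x + rnorm y.
Proof. by rewrite -(rnormN y) rnormD. Qed.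

Lemma rnorm_distC (V : normedZmodType R[i]) (x y : V) :
  rnorm (x - y) = rnorm (y - x).
Proof. by rewrite -rnormN opprB. Qed.

Lemma rnormZ V (a : R[i]) (x : V) : rnorm (a *: x) = rnorm a * rnorm x.
Proof.
by apply: (@complexI R); rewrite rmorphM/= -!rnormE normrZ.
Qed.

Lemma rnorm_real (t : R) : 0 <= t -> rnorm (t%:C : R[i]) = t.
Proof. by move=> t0; rewrite /rnorm ger0_norm ?ler0c. Qed.

(** A set is closed when it contains every point at distance [0] from it. *)
Lemma closed_rnormP V (D : set V) :
  closed D <->
  forall x, (forall e : R, 0 < e -> exists2 y, D y & rnorm (x - y) < e) -> D x.
Proof.
split=> [cD x xD|h].
  apply: cD => U /nbhs_ballP[e e0 eU].
  have e0' : 0 < complex.Re e by move: e0; rewrite /= ltcE => /andP[].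
  have [y Dy xy] := xD _ e0'.
  exists y; split=> //; apply: eU; rewrite -ball_normE /ball_ /= rnormE.
  by move: e0; rewrite /= !ltcE /= => /andP[/eqP -> _]; rewrite eqxx.
apply/closure_id/seteqP; split; first exact: subset_closure.
move=> x xD; apply: h => e e0.
have /xD[y [Dy]] : nbhs x (ball x (e%:C)).
  by apply: nbhsx_ballx; rewrite /= ltcR.
by rewrite -ball_normE /ball_ /= rnormE ltcR => xy; exists y.
Qed.

Lemma bounded_rnormP V1 V2 (T : V1 -> V2) :
  bounded_operator T ->
  exists2 K : R, 0 <= K & forall x, rnorm (T x) <= K * rnorm x.
Proof.
move=> [[a b] Tab]; exists `|a| => // x; have := Tab x.
rewrite !rnormE lecE/= !mulr0 subr0 => /andP[_] /le_trans; apply.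
by rewrite ler_wpM2r ?rnorm_ge0// ler_norm.
Qed.

Lemma geometric_small (c e : R) : 0 <= c -> 0 < e ->
  exists N, forall n, (N <= n)%N -> c / 2 ^+ n < e.
Proof.
move=> c0 e0.
have d0 : 0 < e / (c + 1) by rewrite divr_gt0// ltr_wpDl.
have [N _ hN] := near_infty_natSinv_expn_lt (PosNum d0).
exists N => n /hN /=; rewrite mul1r ltr_pdivlMr ?ltr_wpDl// mulrC.
by apply: le_lt_trans; rewrite ler_wpM2r ?invr_ge0 ?exprn_ge0// lerDl.
Qed.

(** The form in which completeness is used: a sequence with geometrically
decreasing steps converges at a geometric rate. *)
Lemma geometric_cvg (V : completeNormedModType R[i]) (u : nat -> V) (c : R) :
    (forall n, rnorm (u n.+1 - u n) <= c / 2 ^+ n) ->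
  exists l, forall n, rnorm (l - u n) <= 2 * c / 2 ^+ n.
Proof.
move=> uc.
have c0 : 0 <= c.
  by have := uc 0; rewrite expr0 divr1; apply: le_trans (rnorm_ge0 _).
have um n m : rnorm (u (n + m)%N - u n) <= 2 * c / 2 ^+ n.
  suff : rnorm (u (n + m)%N - u n) <= 2 * c / 2 ^+ n - 2 * c / 2 ^+ (n + m).
    move=> /le_trans; apply; rewrite lerBlDr lerDl.
    by rewrite divr_ge0 ?mulr_ge0 ?exprn_ge0.
  elim: m => [|m ih]; first by rewrite addn0 !subrr rnorm0.
  rewrite addnS -(subrK (u (n + m)%N) (u _.+1)) -addrA.
  apply: (le_trans (rnormD _ _)); have := uc (n + m)%N.
  rewrite exprS invfM => h.
  have -> : 2 * c * (2^-1 / 2 ^+ (n + m)) = c / 2 ^+ (n + m).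
    by field; rewrite expf_neq0 // pnatr_eq0.
  move: h ih; rewrite -!mulrA; move: (c / _) (c / _) => a b; lra.
have c20 : 0 <= 2 * c by rewrite mulr_ge0.
have : cvg (u @ \oo).
  apply/cauchy_cvgP; apply: cauchy_exP => e e0.
  have e0' : 0 < complex.Re e by move: e0; rewrite ltcE => /andP[].
  have [N hN] := geometric_small c20 e0'.
  exists (u N); exists N => // n /= Nn; rewrite -ball_normE /ball_ /= rnormE.
  move: e0; rewrite !ltcE/= => /andP[/eqP -> _]; rewrite eqxx/=.
  by rewrite rnorm_distC -(subnKC Nn) (le_lt_trans (um N _))// hN.
move=> /cvg_ex[l ul]; exists l => n.
apply/ler_addgt0Pr => e e0.
have e0' : (0 : R[i]) < e%:C by rewrite ltcR.
have [N _ hN] := cvg_ball ul e0'.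
have := hN (n + N)%N (leq_addl _ _).
rewrite -ball_normE /ball_ /= rnormE ltcR => h.
rewrite -(subrK (u (n + N)%N) l) -addrA (le_trans (rnormD _ _))// [leRHS]addrC.
by rewrite lerD// ltW.
Qed.

Lemma closed_geometric V (D : set V) (u : nat -> V) (l : V) (c : R) :
    closed D -> (forall n, D (u n)) ->
    (forall n, rnorm (l - u n) <= c / 2 ^+ n) -> D l.
Proof.
move=> /closed_rnormP cD Du ul; apply: cD => e e0.
have c0 : 0 <= c.
  by have := ul 0; rewrite expr0 divr1; apply: le_trans (rnorm_ge0 _).
have [N hN] := geometric_small c0 e0.
by exists (u N) => //; rewrite (le_lt_trans (ul N))// hN.
Qed.

Lemma rnorm_geometric_eq0 V (x : V) (c : R) :
  (forall n, rnorm x <= c / 2 ^+ n) -> x = 0.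
Proof.
move=> xc; apply: rnorm_eq0; apply/eqP; rewrite eq_le rnorm_ge0 andbT leNgt.
apply/negP => x0; have c0 : 0 <= c.
  by have := xc 0; rewrite expr0 divr1; apply: le_trans (rnorm_ge0 _).
have [N /(_ N (leqnn _))] := geometric_small c0 x0.
by rewrite ltNge xc.
Qed.

(** If [W] has norm at most [1 / 2], then [1 - W] is onto, with a bounded choice
of preimages; the solution is the limit of [u_(n+1) = x + W u_n]. *)
Lemma neumann (V : completeNormedModType R[i]) (W : {linear V -> V}) :
    (forall x, rnorm (W x) <= rnorm x / 2) ->
  forall x, exists2 v, v - W v = x & rnorm v <= 2 * rnorm x.
Proof.
move=> Wh x; pose u := fun n => iter n (fun v => x + W v) 0.
have [l ul] : exists l, forall n, rnorm (l - u n) <= 2 * rnorm x / 2 ^+ n.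
  apply: geometric_cvg; elim => [|n ih].
    by rewrite /u/= linear0 addr0 subr0 expr0 divr1.
  rewrite /u !iterS opprD addrACA subrr add0r -linearB.
  rewrite (le_trans (Wh _))// exprSr invfM mulrA ler_wpM2r//.
exists l; last by have := ul 0; rewrite subr0 expr0 divr1.
apply/eqP; rewrite -subr_eq0; apply/eqP.
apply: (@rnorm_geometric_eq0 _ _ (2 * rnorm x)) => n.
have -> : l - W l - x = (l - u n.+1) - W (l - u n).
    by rewrite [u n.+1]iterS -/(u n) linearB opprB opprD !addrA subrK addrAC.
apply: le_trans (rnormB _ _) _.
have := Wh (l - u n); have := ul n; have := ul n.+1.
rewrite exprS invfM mulrCA => h1 h2 h3.
move: h1 h2 h3; rewrite -!mulrA.
move: (rnorm x / _) => a; lra.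
Qed.
End RealNorm.

(** * The open mapping theorem on closed subspaces *)

Section OpenMapping.
Variable R : realType.

Lemma submodB (V : lmodType R[i]) (M : submodClosed V) (x y : V) :
  x \in M -> y \in M -> x - y \in M.
Proof. by move=> Mx My; rewrite -scaleN1r rpredD ?rpredZ. Qed.

(** Baire category theorem inside a closed subset [D]: one of countably many
closed sets covering [D] contains a relatively open ball of [D]. *)
Lemma baire_closed (V : completeNormedModType R[i]) (D : set V)
    (F : nat -> set V) :
    closed D -> D !=set0 -> (forall n, closed (F n)) ->
    (forall x, D x -> exists n, F n x) ->
  exists n x (r : R), [/\ 0 < r, D x &
    forall y, D y -> rnorm (x - y) < r -> F n y].
Proof.
move=> cD [x0 Dx0] cF DF; apply: contrapT => noball.
(* A state [(x, r)] stands for the ball of centre [x] and radius [r]; the next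
   ball has its centre in [D], is included in this one and avoids [F n]. *)
have step (p : nat * (V * R)) : exists q : V * R, D p.2.1 -> 0 < p.2.2 ->
    [/\ D q.1, 0 < q.2, q.2 <= p.2.2 / 2, rnorm (q.1 - p.2.1) <= p.2.2 / 2
      & forall z, rnorm (z - q.1) <= q.2 -> ~ F p.1 z].
  case: p => n [x r] /=.
  have [[Dx r0]|] := pselect (D x /\ 0 < r); last first.
    by move=> h; exists (x, r) => Dx r0; case: h.
  have [y [Dy xy nFy]] : exists y, [/\ D y, rnorm (x - y) < r / 2 & ~ F n y].
    apply: contrapT => h; apply: noball; exists n, x, (r / 2).
    split=> //; first by rewrite divr_gt0.
    by move=> y Dy xy; apply: contrapT => nFy; apply: h; exists y.
  have [e e0 ye] : exists2 e : R, 0 < e & forall z, F n z -> e <= rnorm (y - z).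
    apply: contrapT => h; apply: nFy; move/closed_rnormP: (cF n); apply=> e e0.
    apply: contrapT => h'; apply: h; exists e => // z Fz.
    by rewrite leNgt; apply/negP => yz; apply: h'; exists z.
  exists (y, Num.min (r / 2) (e / 2)) => _ _ /=; split=> //.
  - by rewrite lt_min !divr_gt0.
  - by rewrite ge_min lexx.
  - by rewrite rnorm_distC ltW.
  - move=> z; rewrite le_min => /andP[_ ze] /ye; rewrite rnorm_distC; lra.
have [g gP] := choice step.
pose a := fix a n := if n is m.+1 then g (m, a m) else (x0, 1 : R).
have aP n : D (a n).1 /\ 0 < (a n).2.
  by elim: n => [|n [Dn rn]] //=; have [] := gP (n, a n) Dn rn.
pose aS n := gP (n, a n) (aP n).1 (aP n).2.
have rS n : (a n.+1).2 <= (a n).2 / 2 by have [] := aS n.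
have xS n : rnorm ((a n.+1).1 - (a n).1) <= (a n).2 / 2 by have [] := aS n.
have rn n : (a n).2 <= 1 / 2 ^+ n.
  elim: n => [|n ih]; first by rewrite expr0 divr1.
  by rewrite (le_trans (rS n))// exprSr invfM mulrA ler_wpM2r.
have [l la] : exists l, forall n, rnorm (l - (a n).1) <= 2 * 1 / 2 ^+ n.
  apply: geometric_cvg => n; apply: le_trans (xS n) _; have := rn n.
  have := (aP n).2; lra.
have xnm n m : rnorm ((a (n + m)%N).1 - (a n).1) <= (a n).2 - (a (n + m)%N).2.
  elim: m => [|m ih]; first by rewrite addn0 !subrr rnorm0.
  rewrite addnS -(subrK (a (n + m)%N).1 (a _.+1).1) -addrA.
  apply: (le_trans (rnormD _ _)); move: (xS (n + m)%N) (rS (n + m)%N) ih.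
  lra.
have lr n : rnorm (l - (a n).1) <= (a n).2.
  apply/ler_addgt0Pr => e e0.
  have [N hN] := @geometric_small R (2 * 1) e (mulr_ge0 (ler0n _ 2) ler01) e0.
  rewrite -(subrK (a (n + N)%N).1 l) -addrA (le_trans (rnormD _ _))//.
  have := xnm n N; have := (aP (n + N)%N).2; have := la (n + N)%N.
  have := hN (n + N)%N (leq_addl _ _); lra.
have Dl : D l by apply: closed_geometric la => // n; exact: (aP n).1.
have [n Fl] := DF _ Dl.
by have [_ _ _ _] := aS n; move=> /(_ l (lr n.+1)).
Qed.

(** Open mapping theorem for the restriction of [T] to a closed subspace with
closed image: preimages can be chosen with a norm bounded by that of the
image. *)
Lemma open_mapping (V W : completeNormedModType R[i]) (T : {linear V -> W})
    (M : submodClosed V) :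
    bounded_operator T -> closed [set` M] -> closed (T @` [set` M]) ->
  exists2 c : R, 0 <= c & forall x, x \in M ->
    exists x', [/\ x' \in M, T x' = T x & rnorm x' <= c * rnorm (T x)].
Proof.
move=> /bounded_rnormP[K K0 TK] cM cTM.
(* [F n] is the closure of the image of the ball of radius [n] of [M]. *)
pose F n : set W := [set y | forall e : R, 0 < e ->
  exists x, [/\ x \in M, rnorm x <= n%:R & rnorm (y - T x) < e]].
have cF n : closed (F n).
  apply/closed_rnormP => y Fy e e0.
  have e20 : 0 < e / 2 by rewrite divr_gt0.
  have [z Fz yz] := Fy _ e20; have [x [Mx xn zx]] := Fz _ e20.
  exists x; split=> //; rewrite -(subrK z y) -addrA.
  by apply: le_lt_trans (rnormD _ _) _; move: yz zx; lra.
have [n [_ [r [r0 [x0 Mx0 <-] hr]]]] : exists n x (r : R),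
    [/\ 0 < r, (T @` [set` M]) x & forall y, (T @` [set` M]) y ->
      rnorm (x - y) < r -> F n y].
  apply: baire_closed => //; first by exists (T 0), 0 => //=; exact: rpred0.
  move=> _ [x Mx <-]; exists (Num.truncn (rnorm x)).+1 => e e0; exists x.
  by rewrite subrr rnorm0; split=> //; rewrite ltW// truncnS_gt.
pose C := 4 * n%:R / r.
have C0 : 0 <= C by rewrite divr_ge0 ?mulr_ge0 // ltW.
(* An element [z] of the image is approximated, within any [e], by images of
   vectors of norm at most [C * rnorm z]: both [T x0] and [T x0 + t z], with [t]
   such that [t * rnorm z = r / 2], are limits of images of vectors of norm at
   most [n]; take differences and divide by [t]. *)
have approx (p : W * R) : exists x, x \in M /\
    ((T @` [set` M]) p.1 -> 0 < p.2 ->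
      rnorm x <= C * rnorm p.1 /\ rnorm (p.1 - T x) <= p.2).
  case: p => z e /=.
  have [[[x Mx <-] e0]|h] := pselect ((T @` [set` M]) z /\ 0 < e); last first.
    by exists 0; split; [exact: rpred0|move=> ? ?; case: h].
  have [Tx0|Tx0] := eqVneq (rnorm (T x)) 0.
    exists 0; split; first exact: rpred0.
    move=> _ _; rewrite linear0 subr0 Tx0 mulr0 rnorm0.
    by split=> //; exact: ltW.
  have Txp : 0 < rnorm (T x) by rewrite lt_def Tx0 rnorm_ge0.
  pose t := r / 2 / rnorm (T x).
  have t0 : 0 < t by rewrite !divr_gt0.
  have te : 0 < t * e / 2 by rewrite divr_gt0// mulr_gt0.
  have [u [Mu un xu]] : exists u, [/\ u \in M, rnorm u <= n%:R &
      rnorm (T (x0 + t%:C *: x) - T u) < t * e / 2].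
    apply: hr => //.
      by exists (x0 + t%:C *: x) => //=; rewrite rpredD ?rpredZ.
    rewrite linearD linearZ/= opprD addrA subrr add0r rnormN rnormZ.
    rewrite rnorm_real ?ltW//.
    by rewrite /t divfK//; move: r0; lra.
  have [v [Mv vn xv]] : exists u, [/\ u \in M, rnorm u <= n%:R &
      rnorm (T x0 - T u) < t * e / 2].
    by apply: hr => //; rewrite subrr rnorm0.
  have tr : rnorm ((t^-1)%:C : R[i]) = t^-1.
    by rewrite rnorm_real// invr_ge0 ltW.
  exists ((t^-1)%:C *: (u - v)); split; first by apply: rpredZ; apply: submodB.
  move=> _ _; split.
    have uvn : rnorm (u - v) <= 2 * n%:R by have := rnormB u v; lra.
    have -> : C * rnorm (T x) = t^-1 * (2 * n%:R).
      by rewrite /C /t; field; rewrite Tx0 gt_eqF.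
    by rewrite rnormZ tr ler_wpM2l// invr_ge0 ltW.
  have -> : T x - T ((t^-1)%:C *: (u - v)) =
      (t^-1)%:C *: ((T (x0 + t%:C *: x) - T u) - (T x0 - T v)).
    rewrite linearD !linearZ/= linearB.
    have -> : T x0 + t%:C *: T x - T u - (T x0 - T v) =
        t%:C *: T x - (T u - T v).
      by rewrite !opprB addrC !addrA subrK (addrC (t%:C *: T x)).
    by rewrite [in RHS]scalerDr scalerA -rmorphM/= mulVf ?gt_eqF// scale1r.
  rewrite rnormZ tr mulrC ler_pdivrMr //.
  by have := rnormB (T (x0 + t%:C *: x) - T u) (T x0 - T v); lra.
have [g gP] := choice approx.
suff main x : x \in M -> exists x', [/\ x' \in M, T x' = T x
    & rnorm x' <= 2 * C * rnorm (T x)].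
  by exists (2 * C) => //; rewrite mulr_ge0.
move=> Mx; have [Tx0|Tx0] := eqVneq (rnorm (T x)) 0.
  exists 0; split; first exact: rpred0.
    by rewrite linear0 (rnorm_eq0 Tx0).
  by rewrite rnorm0 Tx0 mulr0.
have Txp : 0 < rnorm (T x) by rewrite lt_def Tx0 rnorm_ge0.
pose s := rnorm (T x).
(* The preimage is the limit of successive corrections: the residual at step
   [k] is at most [s / 2^k]. *)
pose u := fix u k := if k is j.+1
  then u j + g (T x - T (u j), s / 2 ^+ j.+1) else 0.
have uP k : u k \in M /\ rnorm (T x - T (u k)) <= s / 2 ^+ k.
  elim: k => [|k [Mu uk]].
    by split; [exact: rpred0|rewrite /= linear0 subr0 expr0 divr1].
  have [Mg /= []] := gP (T x - T (u k), s / 2 ^+ k.+1).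
  - by exists (x - u k); rewrite ?linearB//=; exact: submodB.
  - by rewrite divr_gt0 ?exprn_gt0.
  move=> _; rewrite -addrA -opprD -linearD => h.
  by split=> //; rewrite rpredD.
have uS k : rnorm (u k.+1 - u k) <= (C * s) / 2 ^+ k.
  have [Mu uk] := uP k.
  have [Mg /= []] := gP (T x - T (u k), s / 2 ^+ k.+1).
  - by exists (x - u k); rewrite ?linearB//=; exact: submodB.
  - by rewrite divr_gt0 ?exprn_gt0.
  move=> h _; rewrite [u k + _]addrC addrK (le_trans h)// -mulrA.
  by rewrite ler_wpM2l.
have [l ul] := geometric_cvg uS.
exists l; split.
- by apply: (closed_geometric cM _ ul) => k; exact: (uP k).1.
- apply/eqP; rewrite eq_sym -subr_eq0; apply/eqP.
  apply: (@rnorm_geometric_eq0 _ _ _ (s + K * (2 * (C * s)))) => k.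
  rewrite -(subrK (T (u k)) (T x)) -addrA -[T (u k) - T l]linearB.
  rewrite (le_trans (rnormD _ _))//.
  rewrite mulrDl lerD// ?(uP k).2// (le_trans (TK _))//.
  by rewrite -mulrA ler_wpM2l// rnorm_distC.
- by have := ul 0; rewrite /= subr0 expr0 divr1 mulrA.
Qed.
End OpenMapping.

(** * The direct sum and triangular operators *)

Section DirectSumNorm.
Variables (R : realType) (X Y : normedModType R[i]).
Implicit Types z : dsum X Y.

Lemma dsum_fst_le z : `|z.1| <= `|z|.
Proof.
rewrite -[`|z|]/(sqrtC _) -ler_sqr ?nnegrE ?sqrtC_ge0 ?addr_ge0 ?exprn_ge0//.
by rewrite sqrtCK lerDl exprn_ge0.
Qed.

Lemma dsum_snd_le z : `|z.2| <= `|z|.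
Proof.
rewrite -[`|z|]/(sqrtC _) -ler_sqr ?nnegrE ?sqrtC_ge0 ?addr_ge0 ?exprn_ge0//.
by rewrite sqrtCK lerDr exprn_ge0.
Qed.

Lemma dsum_le z : `|z| <= `|z.1| + `|z.2|.
Proof.
rewrite -[`|z|]/(sqrtC _) -ler_sqr ?nnegrE ?sqrtC_ge0 ?addr_ge0 ?exprn_ge0//.
by rewrite sqrtCK sqrrD addrAC lerDl mulrn_wge0// mulr_ge0.
Qed.

End DirectSumNorm.

Section DirectSumComplete.
Variables (R : realType) (X Y : completeNormedModType R[i]).

Lemma dsum_complete (F : set_system (dsum X Y)) :
  ProperFilter F -> cauchy F -> cvg F.
Proof.
move=> FF /cauchyP Fc.
have /cvg_ex[l1 l1F] : cvg ((fst : dsum X Y -> X) @ F).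
  apply/cauchy_cvgP; apply: cauchy_exP => e e0; have [z Fz] := Fc _ e0.
  exists z.1; change (F (fst @^-1` ball z.1 e)).
  apply: filterS Fz => w; rewrite /= -!ball_normE /ball_/=.
  exact: (le_lt_trans (dsum_fst_le (z - w))).
have /cvg_ex[l2 l2F] : cvg ((snd : dsum X Y -> Y) @ F).
  apply/cauchy_cvgP; apply: cauchy_exP => e e0; have [z Fz] := Fc _ e0.
  exists z.2; change (F (snd @^-1` ball z.2 e)).
  apply: filterS Fz => w; rewrite /= -!ball_normE /ball_/=.
  exact: (le_lt_trans (dsum_snd_le (z - w))).
apply/cvg_ex; exists ((l1, l2) : dsum X Y); apply/cvg_ballP => e e0.
have e20 : 0 < e / 2 by rewrite divr_gt0.
apply: filterS2 (cvg_ball l1F e20) (cvg_ball l2F e20) => z.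
rewrite -!ball_normE /ball_/= => z1 z2; rewrite (splitr e).
exact: (le_lt_trans (dsum_le ((l1, l2) - z : dsum X Y)) (ltrD z1 z2)).
Qed.

HB.instance Definition _ := Uniform_isComplete.Build (dsum X Y) dsum_complete.

End DirectSumComplete.

Section Iterates.
Variables (R : realType) (V : normedModType R[i]) (T : {linear V -> V}).

Lemma iter_is_linear n : linear (iter n T).
Proof. by elim: n => [|n ih] a x y //=; rewrite ih linearP. Qed.

HB.instance Definition _ n := GRing.isLinear.Build R[i] V V _ (iter n T)
  (iter_is_linear n).

Lemma iter_bounded n : bounded_operator T -> bounded_operator (iter n T).
Proof.
move=> /bounded_rnormP[K K0 TK]; exists (K ^+ n)%:C => x.
rewrite !rnormE -rmorphM/= lecR.
elim: n => [|n ih]; first by rewrite expr0 mul1r.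
by rewrite iterS (le_trans (TK _))// exprS -mulrA ler_wpM2l.
Qed.

End Iterates.

Section UpperTriangular.
Variables (R : realType) (X Y : normedModType R[i]).
Variables (A : {linear X -> X}) (B : {linear Y -> Y}) (C : {linear Y -> X}).

Lemma upper_triangular_is_linear : linear (upper_triangular A B C).
Proof.
move=> a [x y] [x' y']; rewrite /upper_triangular /=.
by congr pair; rewrite !linearP//= scalerDr addrACA.
Qed.

HB.instance Definition _ := GRing.isLinear.Build R[i] (dsum X Y) (dsum X Y) _
  (upper_triangular A B C) upper_triangular_is_linear.

Lemma iter_upper_fst n x :
  iter n (upper_triangular A B C) (x, 0) = (iter n A x, 0).
Proof.
by elim: n => [//|n ih]; rewrite iterS ih /upper_triangular/= !linear0 addr0.
Qed.

Lemma iter_upper_snd n z :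
  (iter n (upper_triangular A B C) z).2 = iter n B z.2.
Proof. by elim: n => [//|n ih]; rewrite iterS /= ih. Qed.

End UpperTriangular.

Section Drazin.
Variables (R : realType) (Z : normedModType R[i]) (T S : {linear Z -> Z}).
Variable k : nat.
Hypothesis TS : T \o S =1 S \o T.
Hypothesis TkST : iter k T \o S \o T =1 iter k T.

(** The Drazin inverse commutes with the powers of [T]. *)
Lemma drazin_iterC n z : iter n T (S z) = S (iter n T z).
Proof. by elim: n => [//|n ih]; rewrite !iterS ih; apply: TS. Qed.

Lemma drazin_iterS z : iter k T z = S (iter k.+1 T z).
Proof.
by rewrite -drazin_iterC iterSr -[T (S z)]/((T \o S) z) TS; exact/esym/TkST.
Qed.

End Drazin.

Section DrazinResolvent.
Variables (R : realType) (Z : completeNormedModType R[i]).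
Variables (T S : {linear Z -> Z}) (k : nat).
Hypothesis TS : T \o S =1 S \o T.
Hypothesis STS : S \o T \o S =1 S.
Hypothesis TkST : iter k T \o S \o T =1 iter k T.

(** For [l != 0], the range of [T - l] contains the kernel of every power of
[T]. *)
Lemma nilpotent_vector_solve (l : R[i]) j w : l != 0 -> iter j T w = 0 ->
  exists z, T z - l *: z = w.
Proof.
move=> l0; elim: j w => [|j ih] w.
  by move=> /= ->; exists 0; rewrite linear0 scaler0 subr0.
rewrite iterSr => /ih[z zw]; exists (l^-1 *: (z - w)).
rewrite linearZ linearB scalerA mulfV// scale1r/= -zw.
by rewrite !opprB (addrCA (T z)) subrr addr0 scalerA mulVf// scale1r addrCA
  subrr addr0.
Qed.

Lemma small_neumann (W : {linear Z -> Z}) (K : R) (l : R[i]) :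
    (forall x, rnorm (W x) <= K * rnorm x) -> rnorm l * K <= 2^-1 ->
  forall x, exists2 v, v - l *: W v = x & rnorm v <= 2 * rnorm x.
Proof.
move=> WK lK x.
have lin : linear (fun v => l *: W v).
  by move=> a u v; rewrite linearP scalerDr !scalerA mulrC.
pose lW : {linear Z -> Z} := HB.pack (fun v => l *: W v)
  (GRing.isLinear.Build R[i] Z Z _ (fun v => l *: W v) lin).
apply: (@neumann _ _ lW) => v; rewrite /lW/= rnormZ.
rewrite (le_trans (ler_wpM2l (rnorm_ge0 _) (WK v)))// mulrA [leRHS]mulrC.
by rewrite ler_wpM2r// rnorm_ge0.
Qed.

(** A Drazin invertible operator is bijective after a small nonzero shift. *)
Lemma drazin_punctured : bounded_operator S ->
  exists2 d : R, 0 < d & forall l : R[i], 0 < rnorm l < d ->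
    (forall z, T z - l *: z = 0 -> z = 0) /\
    (forall w, exists z, T z - l *: z = w).
Proof.
move=> /bounded_rnormP[K K0 SK].
(* [K + 1] rather than [K], as [K] may be [0]. *)
exists (2 * (K + 1))^-1 => [|l /andP[l0 ld]].
  by rewrite invr_gt0 mulr_gt0// ltr_wpDl.
have ln0 : l != 0 by apply: contraTneq l0 => ->; rewrite rnorm0 ltxx.
have lK : rnorm l * K <= 2^-1.
  have : rnorm l * (2 * (K + 1)) <= 1.
    by rewrite -ler_pdivlMr ?mulr_gt0 ?ltr_wpDl// mul1r ltW.
  by move: (ltW l0); nra.
have SN := small_neumann SK lK.
split.
  move=> z /eqP; rewrite subr_eq0 => /eqP Tz.
  have itz n : iter n T z = l ^+ n *: z.
    elim: n => [|n ih]; first by rewrite expr0 scale1r.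
    by rewrite iterS ih linearZ/= Tz scalerA -exprSr.
  have : l ^+ k *: z = l ^+ k *: (l *: S z).
    rewrite -itz (drazin_iterS TS TkST) itz linearZ/= exprSr scalerA //.
  move=> /(scalerI (expf_neq0 k ln0)) zSz.
  have := SK z; have : rnorm z = rnorm l * rnorm (S z) by rewrite {1}zSz rnormZ.
  move=> e h; apply: rnorm_eq0; move: (rnorm_ge0 z) (rnorm_ge0 (S z)) (ltW l0).
  by move: lK; nra.
(* Decompose [w = S T w + (w - S T w)]: the second term is killed by [T^k], and
   for the first one [S T v] is a solution, where [v - l S v = S w]. *)
move=> w.
have [v v1 _] := SN (S w).
have [z' z'E] : exists z, T z - l *: z = w - S (T w).
  apply: (@nilpotent_vector_solve l k) => //.
  by rewrite linearB; apply/eqP; rewrite subr_eq0 eq_sym; apply/eqP/TkST.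
exists (S (T v) + z').
rewrite linearD scalerDr opprD addrACA z'E.
suff -> : T (S (T v)) - l *: S (T v) = S (T w) by rewrite addrC subrK.
have TSE x : T (S x) = S (T x) by exact: TS.
have STSE x : S (T (S x)) = S x by exact: STS.
have v'E : S (T v) - l *: S (S (T v)) = S w.
  by rewrite -[RHS]STSE -v1 !linearB !linearZ /= TSE.
rewrite -[S (T w)]TSE -v'E linearB [T (l *: _)]linearZ/=.
by rewrite (TSE (S _)) STSE.
Qed.

End DrazinResolvent.

(** * Dimensions, ascent and descent *)

(** The infimum of a nonempty set of natural numbers is attained. *)
Lemma nat_infP (R : realType) (P : set nat) n : P n ->
  exists p, [/\ P p, (p <= n)%N & nat_inf R P = (p%:R : R)%:E].
Proof.
move=> Pn; have exP : exists m, `[< P m >] by exists n; apply/asboolP.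
case: (ex_minnP exP) => p /asboolP Pp minp; exists p; split=> //.
  exact/minp/asboolP.
apply/eqP; rewrite eq_le; apply/andP; split.
  by apply: ereal_inf_lbound; exists p.
by apply/ereal_infP => _ [m Pm <-]; rewrite lee_fin ler_nat; apply/minp/asboolP.
Qed.

(** If [f] induces an isomorphism from the subspace [U] of [Y] onto the quotient
of [X] by [W], both have the same dimension: bases are transported along [f]
and lifted through it. *)
Lemma quotient_dim_iso (R : realType) (X Y : normedModType R[i])
    (f : {linear Y -> X}) (U : set Y) (W : set X) :
    (forall a y y', U y -> U y' -> U (a *: y + y')) -> U 0 ->
    (forall a x x', W x -> W x' -> W (a *: x + x')) -> W 0 ->
    (forall y, U y -> W (f y) -> y = 0) ->
    (forall x, exists2 y, U y & W (x - f y)) ->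
  quotient_dim setT W = quotient_dim U [set 0].
Proof.
move=> Ulin U0 Wlin W0 finj fsurj; rewrite /quotient_dim; congr nat_inf.
have WN x : W x -> W (- x).
  by move=> Wx; rewrite -scaleN1r -[_ *: x]addr0; apply: Wlin.
have WD x x' : W x -> W x' -> W (x + x').
  by move=> Wx Wx'; rewrite -[x]scale1r; apply: Wlin.
have Usum n (v : 'I_n -> Y) a : (forall i, U (v i)) ->
    U (\sum_(i < n) a i *: v i).
  move=> Uv; elim/big_ind : _ => // [x y Ux Uy|i _].
    by rewrite -[x]scale1r; apply: Ulin.
  by rewrite -[_ *: _]addr0; apply: Ulin.
have Wsum n (v : 'I_n -> X) a : (forall i, W (v i)) ->
    W (\sum_(i < n) a i *: v i).
  move=> Wv; elim/big_ind : _ => // i _.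
  by rewrite -[_ *: _]addr0; apply: Wlin.
have fsum n (v : 'I_n -> Y) a :
    f (\sum_(i < n) a i *: v i) = \sum_(i < n) a i *: f (v i).
  by rewrite linear_sum; apply: eq_bigr => i _; rewrite linearZ.
apply/seteqP; split=> n [v [vU vfree vspan]].
- have /choice[y yP] : forall i, exists y, U y /\ W (v i - f y).
    by move=> i; have [y ? ?] := fsurj (v i); exists y.
  have Wdiff a : W (\sum_(i < n) a i *: v i - f (\sum_(i < n) a i *: y i)).
    rewrite fsum -sumrB; under eq_bigr do rewrite -scalerBr.
    by apply: Wsum => i; exact: (yP i).2.
  exists y; split=> [i|a /= ay0|x Ux]; first exact: (yP i).1.
    by apply: vfree; have := Wdiff a; rewrite ay0 linear0 subr0.
  have [a fxa] := vspan (f x) I; exists a; apply: finj.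
    rewrite addrC -scaleN1r; apply: Ulin => //.
    by apply: Usum => i; exact: (yP i).1.
  rewrite linearB -[f x](subrK (\sum_(i < n) a i *: v i)) -addrA.
  exact: WD.
- exists (f \o v); split=> [//|a|x _].
    rewrite -fsum => /(finj _ (Usum _ _ _ vU)); exact: vfree.
  have [y Uy xy] := fsurj x; have [a ya] := vspan y Uy.
  exists a; rewrite -fsum; suff <- : y = \sum_(i < n) a i *: v i by [].
  by apply/eqP; rewrite -subr_eq0; apply/eqP.
Qed.

Section Restriction.
Variables (R : realType) (V : normedModType R[i]) (T : {linear V -> V}).
Variables (M : submodClosed V) (TM : Defs.invariant T M).

Lemma val_iter_restrict n (x : subspace_type M) :
  val (iter n (Defs.restrict TM) x) = iter n T (val x).
Proof. by elim: n => [//|n ih]; rewrite !iterS -ih. Qed.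

Lemma iter_invariant n x : x \in M -> iter n T x \in M.
Proof. by move=> Mx; elim: n => [//|n ih]; rewrite iterS; exact: TM. Qed.

(** A closed range of the restriction, closed for the topology of the subspace,
is closed in the whole space. *)
Lemma closed_image_restrict :
  closed [set` M] -> closed (range (Defs.restrict TM)) ->
  closed (T @` [set` M]).
Proof.
move=> /closed_rnormP cM /closed_rnormP cr; apply/closed_rnormP => x xTM.
have Mx : x \in M.
  apply: cM => e /xTM[_ [y My <-] xy]; exists (T y) => //=; exact: TM.
pose w : subspace_type M := exist _ x Mx.
have [|w' _ w'w] := cr w.
  move=> e /xTM[_ [y My <-] xy].
  by exists (Defs.restrict TM (exist _ y My : subspace_type M)).
by exists (val w'); [exact: (valP w')|rewrite -[x]/(val w) -w'w].
Qed.

Lemma semi_regular_ker m x : semi_regular (Defs.restrict TM) -> (0 < m)%N ->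
  x \in M -> T x = 0 -> exists2 y, y \in M & x = iter m T y.
Proof.
move=> [_ sr] m0 Mx Tx0; pose w : subspace_type M := exist _ x Mx.
have [|w' _ w'w] := sr m m0 w; first exact: val_inj.
exists (val w'); first exact: (valP w').
by rewrite -val_iter_restrict w'w.
Qed.

(** For a semi-regular restriction, not only the kernel but the kernel of every
power is included in the range. *)
Lemma semi_regular_iter_ker j x : semi_regular (Defs.restrict TM) ->
  x \in M -> iter j T x = 0 -> exists2 y, y \in M & x = T y.
Proof.
move=> sr; elim: j x => [|j ih] x Mx.
  by move=> /= ->; exists 0; rewrite ?rpred0// linear0.
rewrite iterS => /(semi_regular_ker sr (ltn0Sn j) (iter_invariant j Mx))[y My].
rewrite iterSr => jxy.
have [||z Mz xz] := ih (x - T y).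
- by apply: submodB => //; exact: TM.
- by rewrite linearB/= jxy subrr.
exists (z + y); first exact: rpredD.
by rewrite linearD -xz subrK.
Qed.

End Restriction.

Lemma direct_sum_eq (R : realType) (V : normedModType R[i])
    (M N : submodClosed V) u v u' v' : direct_sum M N ->
  u \in M -> u' \in M -> v \in N -> v' \in N -> u + v = u' + v' ->
  u = u' /\ v = v'.
Proof.
move=> [_ MN0] Mu Mu' Nv Nv' e.
have uu' : u - u' = v' - v.
  by apply/eqP; rewrite subr_eq addrAC (addrC v') -e addrK.
have Mu0 : u - u' = 0.
  by apply: MN0; [exact: submodB|rewrite uu'; exact: submodB].
split; first by apply/eqP; rewrite -subr_eq0 Mu0.
by apply/eqP; rewrite eq_sym -subr_eq0 -uu' Mu0.
Qed.

Section LeftDrazin.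
Variables (R : realType) (X : completeNormedModType R[i]) (A : {linear X -> X}).

Lemma ker_iter_stable p : ker (iter p A) = ker (iter p.+1 A) ->
  forall j x, iter (p + j)%N A x = 0 -> iter p A x = 0.
Proof.
move=> pS; elim=> [|j ih] x; first by rewrite addn0.
rewrite addnS iterSr => /ih; rewrite -iterSr => px0.
by suff : ker (iter p A) x by []; rewrite pS.
Qed.

(** An operator that is bounded below on [M], with closed image of [M], maps
closed subsets of [M] to closed sets. *)
Lemma closed_image_bounded_below (M D : set X) (c : R) :
    (forall x, M x -> rnorm x <= c * rnorm (A x)) ->
    (forall x y, M x -> M y -> M (x - y)) ->
    closed (A @` M) -> closed D -> D `<=` M -> closed (A @` D).
Proof.
move=> cA MB /closed_rnormP cAM /closed_rnormP cD DM.
apply/closed_rnormP => y yD.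
have [|x Mx xy] := cAM y.
  move=> e /yD[_ [x Dx <-] yx]; exists (A x) => //.
  by exists x => //; exact: DM.
exists x => //; apply: cD => e e0.
have d0 : 0 < e / (`|c| + 1) by rewrite divr_gt0// ltr_wpDl.
have [_ [z Dz <-]] := yD _ d0; rewrite -xy -linearB => xz.
exists z => //; apply: le_lt_trans (cA _ (MB _ _ Mx (DM _ Dz))) _.
move: xz; rewrite ltr_pdivlMr ?ltr_wpDl// mulrC; apply: le_lt_trans.
by rewrite ler_wpM2r ?rnorm_ge0// (le_trans (ler_norm c))// lerDl ler01.
Qed.

(** An operator of Kato type with finite ascent is left Drazin invertible. *)
Lemma kato_left_drazin k : bounded_operator A -> kato_type A ->
  (forall x, iter k.+1 A x = 0 -> iter k A x = 0) -> left_drazin_invertible A.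
Proof.
move=> bA [M [N [AM [AN [cM cN [MN MN0] srM [n0 n00 AN0]]]]]] Ak.
have kP : ker (iter k A) = ker (iter k.+1 A).
  apply/seteqP; split=> x; last exact: Ak.
  by rewrite /ker/= => ->; exact: linear0.
have [p [pP _ ascp]] := @nat_infP R
  [set n | ker (iter n A) = ker (iter n.+1 A)] k kP.
exists p => //.
have kerp := ker_iter_stable pP.
have ANp x : x \in N -> iter p A x = 0.
  move=> Nx; apply: (kerp n0); rewrite iterD.
  have /(congr1 val) := AN0 (exist _ x Nx).
  by rewrite val_iter_restrict/= => ->; exact: linear0.
have Ainj x : x \in M -> A x = 0 -> x = 0.
  move=> Mx Ax0; have [y My xy] := semi_regular_ker srM (ltn0Sn p) Mx Ax0.
  rewrite xy iterS (kerp 2 y) ?linear0// addn2 iterS -xy; exact: Ax0.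
have cAM := closed_image_restrict cM srM.1.
have [c c0 cA] := open_mapping bA cM cAM.
have bbA x : x \in M -> rnorm x <= c * rnorm (A x).
  move=> Mx; have [x' [Mx' Axx']] := cA x Mx.
  suff -> : x' = x by [].
  apply/eqP; rewrite -subr_eq0; apply/eqP/Ainj; first exact: submodB.
  by rewrite linearB Axx' subrr.
have cAj j : closed (iter j A @` [set` M]).
  elim: j => [|j ih].
    rewrite (_ : _ @` _ = [set` M])//; apply/seteqP.
    by split=> [_ [x Mx <-]//|x Mx]; exists x.
  rewrite (_ : _ @` _ = A @` (iter j A @` [set` M])); last first.
    apply/seteqP; split=> [_ [x Mx <-]|_ [_ [x Mx <-] <-]]; last by exists x.
    by exists (iter j A x) => //; exists x.
  apply: closed_image_bounded_below bbA _ cAM ih _ => [? ?|];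
    first exact: submodB.
  move=> _ [x Mx <-].
  exact: iter_invariant.
rewrite (_ : range _ = iter p.+1 A @` [set` M]); first exact: cAj.
apply/seteqP; split=> [_ [x _ <-]|_ [x _ <-]]; last by exists x.
have [u [v [Mu Nv ->]]] := MN x.
by exists u => //; rewrite [RHS]linearD/= (ANp v Nv) linear0 addr0.
Qed.
End LeftDrazin.

(** * Generalized Kato decompositions and finite descent *)

Section RightDrazin.
Variables (R : realType) (Y : completeNormedModType R[i]).
Variables (B W : {linear Y -> Y}) (k : nat).
Hypotheses (bB : bounded_operator B) (bW : bounded_operator W).
Hypothesis BkW : forall y, iter k B y = iter k.+1 B (W y).

Lemma descent_iter j y : iter k B y = iter (k + j)%N B (iter j W y).
Proof.
elim: j y => [|j ih] y; first by rewrite addn0.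
by rewrite ih iterS addnS -addSn [in RHS]addnC [in LHS]addnC !iterD BkW.
Qed.

(** The kernels of the powers of [B] are stable from [k] on in the second
summand [N] of a decomposition; quasinilpotence of [B] on [N] enters only
through the absence of nonzero eigenvalues. *)
Lemma gkd_ker_stable (M N : submodClosed Y) (BM : Defs.invariant B M)
    (BN : Defs.invariant B N) x :
    closed [set` M] -> direct_sum M N ->
    (forall l y, l != 0 -> y \in N -> B y = l *: y -> y = 0) ->
    x \in N -> iter k.+1 B x = 0 -> iter k B x = 0.
Proof.
move=> cM [MN MN0] Ninj Nx Bx0.
suff Mx : iter k B x \in M by exact: MN0 Mx (iter_invariant BN k Nx).
move/closed_rnormP: cM; apply=> e e0.
have [K K0 WK] := bounded_rnormP bW.
have [L L0 BL] := bounded_rnormP (iter_bounded k bB).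
pose b := L * (K * (2 * rnorm x)).
have b0 : 0 <= b by rewrite !mulr_ge0 ?rnorm_ge0.
(* [t] is small enough for [1 - t W] to be invertible, and for its solution [v]
   below to satisfy [rnorm (B^k x - B^k v) <= t * b < e]. *)
pose t := (2 * K + b / e + 1)^-1.
have be0 : 0 <= b / e by rewrite divr_ge0// ltW.
have s0 : 0 < 2 * K + b / e + 1 by move: K0 be0; lra.
have t0 : 0 < t by rewrite invr_gt0.
have tK : t * K <= 2^-1.
  rewrite mulrC ler_pdivrMr//; move: be0; lra.
have tb : t * b < e.
  rewrite mulrC ltr_pdivrMr// mulrDr mulrDr mulr1.
  rewrite (_ : e * (b / e) = b); last by rewrite mulrC divfK// gt_eqF.
  have : 0 <= e * (2 * K) by apply: mulr_ge0; [exact: ltW|exact: mulr_ge0].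
  move: e0; lra.
pose l : R[i] := t%:C.
have nl : rnorm l = t by rewrite rnorm_real// ltW.
have l0 : l != 0 by apply: contraTneq t0 => l0; rewrite -nl l0 rnorm0 ltxx.
have lK : rnorm l * K <= 2^-1 by rewrite nl.
have [v vx nv] := small_neumann WK lK x.
exists (iter k B v); last first.
  have xv : x - v = - (l *: W v) by rewrite -vx addrAC subrr add0r.
  rewrite -linearB xv; apply: le_lt_trans tb; apply: le_trans (BL _) _.
  rewrite rnormN rnormZ nl /b mulrCA ler_wpM2l// ?(ltW t0)// ler_wpM2l//.
  by rewrite (le_trans (WK _))// ler_wpM2l.
(* [B^k v] is an eigenvector of [B] for [l], hence has no component in [N] *)
have eig : B (iter k B v) = l *: iter k B v.
  apply/eqP; rewrite -subr_eq0 -iterS BkW -[l *: iter k.+1 B (W v)]linearZ.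
  rewrite -linearB vx.
  exact/eqP.
have [m [n [Mm Nn e']]] := MN (iter k B v).
suff n0 : n = 0 by rewrite /= e' n0 addr0.
apply: (Ninj _ _ l0 Nn).
have [] := @direct_sum_eq _ _ M N (B m) (B n) (l *: m) (l *: n)
  (conj MN MN0) => //.
- exact: BM.
- exact: rpredZ.
- exact: BN.
- exact: rpredZ.
- by rewrite -scalerDr -linearD -e'.
Qed.

Lemma range_iter_stable q : range (iter q B) = range (iter q.+1 B) ->
  forall j, range (iter (q + j)%N B) = range (iter q B).
Proof.
move=> qS; elim=> [|j ih]; first by rewrite addn0.
rewrite -ih; apply/seteqP; split=> _ [y _ <-].
  by exists (B y); rewrite // addnS iterSr.
rewrite [in iter (q + j) B y]addnC iterD.
have [z _ <-] : range (iter q.+1 B) (iter q B y) by rewrite -qS; exists y.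
by exists z => //; rewrite -iterD addnC addSnnS.
Qed.

(** An operator [B] with a generalized Kato decomposition is right Drazin
invertible as soon as [B^k = B^(k+1) W] for some bounded operator [W]. *)
Lemma gkd_right_drazin : generalized_kato B -> right_drazin_invertible B.
Proof.
move=> [M [N [BM [BN [cM cN MN srM qN]]]]].
have kP : range (iter k B) = range (iter k.+1 B).
  apply/seteqP; split=> _ [y _ <-].
    by exists (W y); rewrite -?BkW.
  by exists (B y); rewrite // iterSr.
have [q [qP qk dscq]] := @nat_infP R
  [set n | range (iter n B) = range (iter n.+1 B)] k kP.
(* Past the descent [q] the ranges agree, so it suffices to treat [B^k]. *)
exists q => //; rewrite -(range_iter_stable qP (k - q)) subnKC//.
have Ninj l y : l != 0 -> y \in N -> B y = l *: y -> y = 0.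
  move=> l0 Ny Byl; have [S [_ SK _]] := qN l l0.
  pose w : subspace_type N := exist _ y Ny.
  have w0 : minus_scalar (Defs.restrict BN) l w =
      minus_scalar (Defs.restrict BN) l 0.
    by apply: val_inj; rewrite /minus_scalar /= linear0 scaler0 subr0 Byl subrr.
  by have /(congr1 val) := can_inj SK w0.
have Nker j x : x \in N -> iter (k + j)%N B x = 0 -> iter k B x = 0.
  move=> Nx; elim: j => [|j ih]; first by rewrite addn0.
  rewrite -addSnnS iterD => h; apply: ih; rewrite iterD.
  exact: (gkd_ker_stable BM BN cM MN Ninj (iter_invariant BN j Nx) h).
(* [B] maps [M] onto itself: for [y] in [M], if [m] is the component of [W y] in
   [M], then [y - B m] is in the kernel of [B^k], hence in [B @` M]. *)
have BMsurj y : y \in M -> exists2 z, z \in M & B z = y.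
  move=> My.
  have [m [n [Mm Nn Wy]]] := MN.1 (W y).
  have [] := @direct_sum_eq _ _ M N (iter k B y) 0
    (iter k.+1 B m) (iter k.+1 B n) MN.
  - exact: iter_invariant.
  - exact: iter_invariant.
  - exact: rpred0.
  - exact: iter_invariant.
  - by rewrite addr0 -linearD -Wy BkW.
  move=> e _.
  have [||z Mz yz] := semi_regular_iter_ker (x := y - B m) (j := k) srM.
  - by apply: submodB => //; exact: (BM).
  - rewrite [LHS]linearB; apply/eqP; rewrite subr_eq0; apply/eqP.
    exact: etrans e (iterSr _ _ _).
  exists (z + m); first exact: rpredD.
  by rewrite linearD -yz subrK.
have BkM y : y \in M -> range (iter k B) y.
  suff h j : y \in M -> exists2 z, z \in M & iter j B z = y.
    by move=> /(h k)[z _ <-]; exists z.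
  elim: j y => [|j ih] y My; first by exists y.
  have [z Mz <-] := BMsurj y My; have [u Mu <-] := ih z Mz.
  by exists u.
pose E y := y - iter k B (iter k W y).
have kerE y : iter k B (E y) = 0.
  rewrite [LHS]linearB; apply/eqP; rewrite subr_eq0; apply/eqP.
  by rewrite [LHS](descent_iter k) [LHS]iterD.
(* An element of both the kernel and the range of [B^k] is in [M], as the
   kernels of the powers are stable on [N]. *)
have rangeE y : range (iter k B) y -> E y \in M.
  move=> [s _ sy].
  pose s' := s - iter k W y.
  have Es : E y = iter k B s' by rewrite [RHS]linearB/= -sy.
  have [m [n [Mm Nn mn]]] := MN.1 s'.
  have n0 : iter k B n = 0.
    apply: (Nker k) => //; rewrite iterD.
    have [] := @direct_sum_eq _ _ M N 0 (iter k B (iter k B n))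
      (- iter k B (iter k B m)) 0 MN => //.
    - exact: rpred0.
    - by rewrite -scaleN1r rpredZ// !iter_invariant.
    - by rewrite !iter_invariant.
    - exact: rpred0.
    - apply/eqP; rewrite add0r addr0 eq_sym -subr_eq0 -opprD oppr_eq0.
      have := kerE y; rewrite Es mn !linearD => /eqP.
      by [].
  rewrite Es mn linearD/= n0 addr0; exact: iter_invariant.
apply/closed_rnormP => y yr.
have : E y \in M.
  move/closed_rnormP: cM; apply=> e e0.
  have [L L0 BL] := bounded_rnormP (iter_bounded k bB).
  have [K K0 WK] := bounded_rnormP (iter_bounded k bW).
  have c0 : 0 < 1 + L * K by rewrite ltr_wpDr// mulr_ge0.
  have [z zr yz] := yr _ (divr_gt0 e0 c0).
  exists (E z); first exact: rangeE.
  have -> : E y - E z = (y - z) - iter k B (iter k W (y - z)).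
    rewrite [iter k W (y - z)]linearB [iter k B (_ - _)]linearB.
    by rewrite /E !opprD !opprK addrACA.
  apply: le_lt_trans (rnormB _ _) _; move: yz; rewrite ltr_pdivlMr//.
  apply: le_lt_trans; rewrite mulrC mulrDl mul1r lerD2l.
  by rewrite (le_trans (BL _))// -mulrA ler_wpM2l.
move=> /BkM[z _ zE]; exists (z + iter k W y) => //.
by rewrite linearD/= zE /E subrK.
Qed.
End RightDrazin.

(** * Triangular operators with a Drazin invertible matrix *)

Section Corner.
Variables (R : realType) (X Y : normedModType R[i]).
Variable S : {linear dsum X Y -> dsum X Y}.

(** The lower right entry of [S], as an operator matrix. *)
Definition corner (y : Y) : Y := (S (0, y)).2.

Lemma corner_is_linear : linear corner.
Proof.
move=> a u v; rewrite /corner.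
have -> : ((0, a *: u + v) : dsum X Y) = a *: ((0, u) : dsum X Y) + (0, v).
  by congr pair; rewrite /= scaler0 addr0.
by rewrite linearP.
Qed.

HB.instance Definition _ := GRing.isLinear.Build R[i] Y Y _ corner
  corner_is_linear.

Lemma corner_bounded : bounded_operator S -> bounded_operator corner.
Proof.
move=> [K SK]; exists K => y; apply: le_trans (dsum_snd_le _) _.
apply: le_trans (SK _) _.
rewrite -[`|(0, y) : dsum X Y|]/(dsum_norm _) /dsum_norm.
rewrite normr0 expr0n add0r.
by rewrite sqrCK.
Qed.

End Corner.

(** Bijectivity of the triangular operator minus [l] makes [C] induce an
isomorphism from the kernel of [B - l] onto the cokernel of [A - l], as in the
snake lemma. *)
Lemma upper_triangular_index (R : realType) (X Y : normedModType R[i])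
    (A : {linear X -> X}) (B : {linear Y -> Y}) (C : {linear Y -> X})
    (l : R[i]) :
    (forall z, upper_triangular A B C z - l *: z = 0 -> z = 0) ->
    (forall w, exists z, upper_triangular A B C z - l *: z = w) ->
  beta (minus_scalar A l) = alpha (minus_scalar B l).
Proof.
move=> inj surj; apply: (@quotient_dim_iso _ _ _ C).
- move=> a y y'; rewrite /ker /minus_scalar/= => y0 y'0.
  rewrite linearP scalerDr scalerA mulrC -scalerA opprD addrACA y'0 addr0.
  by rewrite -scalerBr y0 scaler0.
- by rewrite /ker /minus_scalar/= linear0 scaler0 subr0.
- move=> a _ _ [x _ <-] [x' _ <-]; exists (a *: x + x') => //.
  rewrite /minus_scalar linearP scalerDr scalerA mulrC -scalerA opprD addrACA.
  by rewrite -scalerBr.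
- by exists 0; rewrite // /minus_scalar linear0 scaler0 subr0.
- move=> y y0 [x _ xy].
  have /(congr1 snd) // : ((- x, y) : dsum X Y) = 0.
  apply: inj; congr pair => //=.
  rewrite linearN scalerN opprK -xy /minus_scalar.
  by rewrite addKr addNr.
- move=> x; have [[x' y] /= e] := surj ((x, 0) : dsum X Y).
  case: e => e1 e2; exists y => //; exists x' => //.
  by rewrite -e1 /minus_scalar addrAC addrK.
Qed.

Unset Implicit Arguments.

Theorem theorem2p7 (R : realType) (X Y : completeNormedModType R[i])
    (A : {linear X -> X}) (B : {linear Y -> Y})
    (hA : bounded_operator A) (hB : bounded_operator B)
    (katoA : kato_type A) (gkdB : generalized_kato B)
    (hC : exists C : {linear Y -> X},
      bounded_operator C /\ drazin_invertible (upper_triangular A B C)) :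
  [/\ left_drazin_invertible A,
      right_drazin_invertible B
    & exists2 delta : R, 0 < delta &
        forall l : R[i], 0 < `|l| < delta%:C ->
          beta (minus_scalar A l) = alpha (minus_scalar B l)].
Proof.
have [C [_ [S [k [bS _ TS STS TkST]]]]] := hC.
have TkS := @drazin_iterS _ _ _ S k TS TkST.
split.
- apply: (@kato_left_drazin _ _ _ k) => // x Ax0.
  have := TkS (x, 0); rewrite !iter_upper_fst Ax0.
  by move=> /(congr1 fst)/= ->; rewrite -[(0, 0)]/(0 : dsum X Y) linear0.
- apply: (@gkd_right_drazin _ _ B (corner S) k hB (corner_bounded bS)) => // y.
  have := TkS (0, y); rewrite -drazin_iterC // => /(congr1 snd).
  by rewrite !iter_upper_snd.
- have [d d0 dP] := drazin_punctured TS STS TkST bS; exists d => // l.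
  rewrite rnormE !ltcR => /dP[inj surj]; exact: upper_triangular_index inj surj.
Qed.
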